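(* Let $d,p\ge 1$ and $n\ge 0$ be integers. Let $\phi$ and $\psi_1,\dots,\psi_d$ be kernels of order $n$, all belonging to $C_b^{p}(\mathbb{R})$, such that for every $q=1,\dots,p$ the series $$\sum_{k\in\mathbb{Z}}|u-k|^{n}\,|\phi^{(q)}(u-k)|\quad\text{and}\quad \sum_{k\in\mathbb{Z}}|u-k|^{n}\,|\psi_i^{(q)}(u-k)|,\qquad i=1,\dots,d,$$ are uniformly convergent in $u\in\mathbb{R}$. Then for every $f\in C_b^{n}(\mathbb{R}\times\mathbb{R}^{d})$ and every $w>0$ we have $K_{n,w}^{\phi,\psi}f\in C_b^{p}(\mathbb{R}\times\mathbb{R}^{d})$.
   Context: Notation. For a multi-index $\mathbf{j}\in\mathbb{Z}_+^d$ (non-negative integer entries): $|\mathbf{j}|=j_1+\dots+j_d$, $\mathbf{j}!=\prod_i j_i!$, and $\mathbf{x}^{\mathbf{j}}=\prod_i x_i^{j_i}$ for $\mathbf{x}\in\mathbb{R}^d$; $0^0=1$. Points of $\mathbb{R}\times\mathbb{R}^d$ are written $(x,\mathbf{y})$. Function spaces. $C_b(X)$ is the space of bounded continuous real functions on $X$. $C_b^{m}(X)$ (for $X=\mathbb{R}$ or $X=\mathbb{R}\times\mathbb{R}^d$) is the space of $m$-times continuously differentiable real functions all of whose partial derivatives of order at most $m$ belong to $C_b(X)$. Uniform convergence of moment series. For $g:\mathbb{R}\to\mathbb{R}$, the series $\sum_{k\in\mathbb{Z}}|u-k|^{n}|g(u-k)|$ is called uniformly convergent in $u\in\mathbb{R}$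 if it converges for every $u$ and $\lim_{R\to\infty}\sup_{u\in\mathbb{R}}\sum_{k\in\mathbb{Z},\,|u-k|\ge R}|u-k|^{n}|g(u-k)|=0$. Kernels. For $\chi:\mathbb{R}\to\mathbb{R}$ and $\beta\ge0$ put $M_\beta(\chi)=\sup_{u\in\mathbb{R}}\sum_{k\in\mathbb{Z}}|u-k|^{\beta}|\chi(u-k)|$. The function $\chi$ is a kernel of order $n$ if (i) $\sum_{k\in\mathbb{Z}}\chi(u-k)=1$ for every $u\in\mathbb{R}$; (ii) the series $\sum_{k\in\mathbb{Z}}|u-k|^{n}|\chi(u-k)|$ is uniformly convergent in $u\in\mathbb{R}$, i.e. it converges for every $u$ and $\lim_{R\to\infty}\sup_{u\in\mathbb{R}}\sum_{k\in\mathbb{Z},\,|u-k|\ge R}|u-k|^{n}|\chi(u-k)|=0$, and $M_\beta(\chi)<\infty$ for all $0\le\beta\le n$. Operator. For $w>0$, $k\in\mathbb{Z}$, $\mathbf{m}\in\mathbb{Z}^d$ let $I_k^w=[\frac{k}{w},\frac{k+1}{w}]$ and $I_{\mathbf{m}}^w=\prod_{i=1}^d[\frac{m_i}{w},\frac{m_i+1}{w}]$. The Hermite-type sampling Kantorovich operator is $$K_{n,w}^{\phi,\psi}f(x,\mathbf{y})=\sum_{k\in\mathbb{Z}}\sum_{\mathbf{m}\in\mathbb{Z}^d}\phi(wx-k)\prod_{i=1}^d\psi_i(wy_i-m_i)\left(\sum_{l+|\mathbf{j}|\le n}\frac{1}{l!\,\mathbf{j}!}\,w^{d+1}\int_{I_k^w}\int_{I_{\mathbf{m}}^w}\frac{\partial^{l+|\mathbf{j}|}f(u,\mathbf{v})}{\partial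 u^l\partial\mathbf{v}^{\mathbf{j}}}(x-u)^l(\mathbf{y}-\mathbf{v})^{\mathbf{j}}\,d\mathbf{v}\,du\right),$$ where the inner sum is over integers $l\ge0$ and $\mathbf{j}\in\mathbb{Z}_+^d$. *)

(* Defs.v *)
From mathcomp Require Import all_boot all_order all_algebra.
From mathcomp Require Import all_classical all_reals all_analysis.
Import Order.TTheory GRing.Theory Num.Theory.
Import numFieldNormedType.Exports.

Set Implicit Arguments.
Unset Strict Implicit.
Unset Printing Implicit Defensive.

Local Open Scope classical_set_scope.
Local Open Scope ring_scope.

(* Unordered sum of a family of reals: the sum of the positive parts minus the
   sum of the negative parts.  It is the value of the series when the family is
   [summable] (absolutely convergent), and a junk value otherwise. *)
Definition usum (R : realType) (T : choiceType) (a : T -> R) : R :=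
  let f t := (a t)%:E in
  fine (esum [set: T] f^\+ - esum [set: T] f^\-)%E.

Definition usummable (R : realType) (T : choiceType) (a : T -> R) : Prop :=
  summable [set: T] (fun t => (a t)%:E).

Definition Cb (R : realType) (V : normedModType R) (f : V -> R) : Prop :=
  continuous f /\ bounded_fun f.

Definition Cbm_line (R : realType) (m : nat) (f : R -> R) : Prop :=
  (forall q, (q < m)%N -> forall x, derivable (derive1n q f) x 1) /\
  (forall q, (q <= m)%N -> Cb (derive1n q f)).

(* Points of R x R^d are pairs (x, y) with y a row vector.  The coordinate
   directions are indexed by [option 'I_d]: [None] is the direction of x and
   [Some i] that of y_i. *)
Definition cdir (R : realType) (d : nat) (c : option 'I_d) : R * 'rV[R]_d :=
  if c is Some i then (0, delta_mx 0 i) else (1, 0).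

(* Iterated partial derivative along a word of coordinates; the head of the
   word is the coordinate differentiated last. *)
Definition pderivs (R : realType) (d : nat) (s : seq (option 'I_d))
    (f : R * 'rV[R]_d -> R) : R * 'rV[R]_d -> R :=
  foldr (fun c g => 'D_(cdir R c) g) f s.

Definition Cbm (R : realType) (d m : nat) (f : R * 'rV[R]_d -> R) : Prop :=
  (forall s : seq (option 'I_d), (size s < m)%N ->
     forall c z, derivable (pderivs s f) z (cdir R c)) /\
  (forall s : seq (option 'I_d), (size s <= m)%N -> Cb (pderivs s f)).

Section kernels.
Variable R : realType.
Implicit Types g chi : R -> R.

Definition moment_cvg_unif (n : nat) g : Prop :=
  (forall u : R, (\esum_(k in [set: int])
      (`|u - k%:~R| ^+ n * `|g (u - k%:~R)|)%:E < +oo)%E) /\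
  (ereal_sup (range (fun u : R =>
      \esum_(k in [set k : int | (r <= `|u - k%:~R|)%R])
        (`|u - k%:~R| ^+ n * `|g (u - k%:~R)|)%:E)) @[r --> +oo%R] --> 0%E).

Definition abs_moment (beta : R) chi : \bar R :=
  ereal_sup (range (fun u : R =>
    \esum_(k in [set: int])
      (`|u - k%:~R| `^ beta * `|chi (u - k%:~R)|)%:E)).

Definition kernel_of_order (n : nat) chi : Prop :=
  [/\ forall u : R, usum (fun k : int => chi (u - k%:~R)) = 1,
      moment_cvg_unif n chi
    & forall beta : R, 0 <= beta <= n%:R -> (abs_moment beta chi < +oo)%E].

End kernels.

Section operator.
Variables (R : realType) (d : nat).

(* Iterated Lebesgue integral of g over the box \prod_i A i.  The base point 0
   is irrelevant: each of its coordinates is overwritten once. *)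
Definition box_integral (A : 'I_d -> set R) (g : 'rV[R]_d -> R) : R :=
  foldr (fun (i : 'I_d) (h : 'rV[R]_d -> R) (v : 'rV[R]_d) =>
           \int[@lebesgue_measure R]_(t in A i)
             h (\row_j (if j == i then t else v 0 j)))
        g (enum 'I_d) 0.

Definition cell (w : R) (k : int) : set R :=
  `[k%:~R / w, (k + 1)%:~R / w]%classic.

(* The word of coordinates of \partial^{l+|j|} / \partial u^l \partial v^j. *)
Definition mixed_word (l : nat) (j : 'I_d -> nat) : seq (option 'I_d) :=
  nseq l None ++ flatten [seq nseq (j i) (Some i) | i <- enum 'I_d].

(* Multi-indices with l + |j| <= n have all entries at most n, whence the
   finite index types. *)
Definition hermite_mean (n : nat) (w : R) (f : R * 'rV[R]_d -> R)
    (k : int) (m : {ffun 'I_d -> int}) (x : R) (y : 'rV[R]_d) : R :=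
  \sum_(l < n.+1)
  \sum_(j : {ffun 'I_d -> 'I_n.+1} | (l + \sum_(i < d) j i <= n)%N)
    ((l`!)%:R * \prod_(i < d) ((j i)`!)%:R)^-1 * w ^+ d.+1 *
    \int[@lebesgue_measure R]_(u in cell w k)
      box_integral (fun i => cell w (m i)) (fun v =>
        pderivs (mixed_word l (fun i => j i)) f (u, v) *
        (x - u) ^+ l * \prod_(i < d) (y 0 i - v 0 i) ^+ j i).

Variables (n : nat) (phi : R -> R) (psi : 'I_d -> R -> R).

Definition hermite_term (w : R) (f : R * 'rV[R]_d -> R) (z : R * 'rV[R]_d)
    (k : int) (m : {ffun 'I_d -> int}) : R :=
  phi (w * z.1 - k%:~R) * (\prod_(i < d) psi i (w * z.2 0 i - (m i)%:~R)) *
  hermite_mean n w f k m z.1 z.2.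

Definition hermite_kantorovich (w : R) (f : R * 'rV[R]_d -> R)
    (z : R * 'rV[R]_d) : R :=
  usum (fun k : int => usum (hermite_term w f z k)).

(* [usum] is total, so the convergence of the double series is a separate
   property. *)
Definition hermite_kantorovich_cvg (w : R) (f : R * 'rV[R]_d -> R)
    (z : R * 'rV[R]_d) : Prop :=
  (forall k : int, usummable (hermite_term w f z k)) /\
  usummable (fun k : int => usum (hermite_term w f z k)).

End operator.

(* Main.v *)
Require Import Defs.
From mathcomp Require Import all_boot all_order all_algebra.
From mathcomp Require Import finmap.
From mathcomp Require Import all_classical all_reals all_analysis.
From mathcomp Require Import ring lra.
Import Order.TTheory GRing.Theory Num.Theory.
Import numFieldNormedType.Exports.

(** ** Why the operator is smooth

    Expand each power [(z_c - zeta_c)^l] in the mean over a cell around the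
    corner [kappa_c / w] of that cell.  The mean becomes a polynomial in the
    variables [w z_c - kappa_c], with exponents at most [n] in each of them and
    with coefficients bounded independently of the cell: the partial derivatives
    of [f] are bounded, and [|zeta_c - kappa_c / w| <= 1 / w] on the cell
    ([hermite_meanE], [hermite_coef_bounded]).  Absorbing the monomials into the
    kernels, the operator is a finite sum of sampling series
    [sum_kappa b(kappa) * prod_c g_c (w z_c - kappa_c)] with [b] bounded and
    [g_c(x) = x^a * chi_c(x)], [a <= n].  Multiplication by the variable costs
    one moment and no derivative, so the derivatives of [g_c] up to order [p]
    still have uniformly small tails ([smooth_tails_monomial]).

    The formal partial derivative of a sampling series in the direction [c] is
    [w] times the series in which [g_c] is replaced by its derivative, hence a
    series of the same kind, and [p] successive differentiations stay within
    reach of the hypotheses ([sampling_Cbm]).  That they may be carried out term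
    by term rests on one property, [loc_unif]: near every point, the absolute
    sum over the indices outside some finite set is uniformly small.  Series of
    continuous functions with this property are continuous
    ([loc_unif_continuous]), and if it holds for a series and for the series of
    derivatives, the sum is differentiable ([loc_unif_derive]).  The Weierstrass
    criterion would not do here: for the derivative of the highest order the
    hypotheses do not make the suprema of [|g (u - k)|] over a bounded interval
    of [u] summable in [k].  The mean value theorem is applied to finite partial
    sums instead.

    A product series inherits the property from its factors: outside a large box
    of multi-indices some entry is far from [w z_c], the corresponding factor
    contributes a small tail, and the other factors contribute their bounded
    full sums ([sum_le_prod_tail], [unif_tails_bounded]).  The iterated sum in
    the definition of the operator equals the single sum over multi-indices by
    Fubini's theorem for absolutely convergent families ([usum_pair]). *)

Set Implicit Arguments.
Unset Strict Implicit.
Unset Printing Implicit Defensive.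

Local Open Scope classical_set_scope.
Local Open Scope ring_scope.

(** * Unordered sums of absolutely convergent families *)

Section usum.
Variable R : realType.

(** Bounding the finite partial sums says the same as bounding the extended real
    sum ([sum_leP]), but it keeps estimates inside the real field and applies
    directly to the finite sums on which the mean value theorem is used. *)
Definition sum_le (T : choiceType) (A : set T) (a : T -> R) (M : R) : Prop :=
  forall X : {fset T}, [set` X] `<=` A -> \sum_(t <- X) `|a t| <= M.

Lemma sum_leP (T : choiceType) (A : set T) (a : T -> R) (M : R) :
  sum_le A a M <-> (\esum_(t in A) (`|a t|)%:E <= M%:E)%E.
Proof.
split=> [aM|aM X XA].
  apply: ge_ereal_sup => _ [X [finX XA] <-].
  rewrite fsbig_finite//= sumEFin lee_fin; apply: aM => t /=.
  by rewrite in_fset_set// inE; exact: XA.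
rewrite -lee_fin -sumEFin; apply: le_trans aM; apply: esum_ge.
exists [set` X]; first by split=> //; exact: finite_fset.
by rewrite fsbig_finite//= set_fsetK.
Qed.

Lemma sum_le_ge0 (T : choiceType) (A : set T) (a : T -> R) (M : R) :
  sum_le A a M -> 0 <= M.
Proof. by move=> /(_ fset0); rewrite big_seq_fset0; apply => ?; rewrite /= inE. Qed.

Lemma sum_leW (T : choiceType) (A B : set T) (a b : T -> R) (M N : R) :
  A `<=` B -> (forall t, A t -> `|a t| <= `|b t|) -> M <= N ->
  sum_le B b M -> sum_le A a N.
Proof.
move=> AB ab MN bM X XA; apply: le_trans MN.
apply: le_trans (bM X (subset_trans XA AB)).
by rewrite big_seq [leRHS]big_seq; apply: ler_sum => t /XA /ab.
Qed.

Lemma sum_leD (T : choiceType) (A : set T) (a b : T -> R) (M N : R) :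
  sum_le A a M -> sum_le A b N -> sum_le A (fun t => a t + b t) (M + N).
Proof.
move=> aM bN X XA; apply: le_trans (lerD (aM X XA) (bN X XA)).
by rewrite -big_split; apply: ler_sum => t _; exact: ler_normD.
Qed.

Lemma sum_leZ (T : choiceType) (A : set T) (a : T -> R) (c M : R) :
  sum_le A a M -> sum_le A (fun t => c * a t) (`|c| * M).
Proof.
move=> aM X XA; under eq_bigr do rewrite normrM.
by rewrite -mulr_sumr ler_wpM2l// aM.
Qed.

Lemma sum_leB (T : choiceType) (A : set T) (a b : T -> R) (M N : R) :
  sum_le A a M -> sum_le A b N -> sum_le A (fun t => a t - b t) (M + N).
Proof.
move=> aM bN; apply: (@sum_leD _ _ a (fun t => - b t)) => // X XA.
by under eq_bigr do rewrite normrN; exact: bN.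
Qed.

Lemma usummableP (T : choiceType) (a : T -> R) :
  usummable a <-> exists M, sum_le setT a M.
Proof.
rewrite /usummable summableE; split => [aM|[M /sum_leP aM]].
  exists (fine (\esum_(t in setT) `|(a t)%:E|)%E).
  by apply/sum_leP; rewrite fineK.
rewrite ge0_fin_numE; first exact: le_lt_trans aM (ltry _).
by apply: esum_ge0.
Qed.

(** The remainder of an absolutely convergent family beyond a finite set of
    indices is controlled by the tail of the absolute values: the positive and
    the negative part of the remainder both lie between 0 and that tail. *)
Lemma usum_approx (T : choiceType) (a : T -> R) (X : {fset T}) (e : R) :
  usummable a -> sum_le (~` [set` X]) a e ->
  `|usum a - \sum_(t <- X) a t| <= e.
Proof.
move=> sa /sum_leP ae; rewrite /usum.
set f := fun t => (a t)%:E.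
have part (g : T -> \bar R) : (forall t, 0 <= g t <= `|f t|)%E ->
    exists2 r : R, 0 <= r <= e &
    (\esum_(t in setT) g t = (\sum_(t <- X) fine (g t) + r)%:E)%E.
  move=> g0; have gf t : g t \is a fin_num.
    rewrite ge0_fin_numE; first by case/andP: (g0 t) => _ /le_lt_trans; apply; exact: ltry.
    by case/andP: (g0 t).
  have h0 : (0 <= \esum_(t in ~` [set` X]) g t)%E.
    by apply: esum_ge0 => t _; case/andP: (g0 t).
  have he : (\esum_(t in ~` [set` X]) g t <= e%:E)%E.
    by apply: le_trans ae; apply: le_esum => t _; case/andP: (g0 t).
  have hf : (\esum_(t in ~` [set` X]) g t)%E \is a fin_num.
    by rewrite ge0_fin_numE//; exact: le_lt_trans he (ltry _).
  exists (fine (\esum_(t in ~` [set` X]) g t)%E).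
    by rewrite -!lee_fin fineK// h0.
  rewrite (esumID [set` X]); last by move=> t _; case/andP: (g0 t).
  rewrite !setTI EFinD fineK//; congr (_ + _)%E.
  rewrite esum_fset; [|exact: finite_fset|by move=> t _; case/andP: (g0 t)].
  rewrite fsbig_finite//= set_fsetK -sumEFin.
  by apply: eq_bigr => t _; rewrite fineK.
have [|r /andP[r0 re] ->] := part f^\+%E.
  by move=> t; rewrite -/((abse \o f) t) fune_abse funepos_ge0/= leeDl.
have [|s /andP[s0 se] ->] := part f^\-%E.
  by move=> t; rewrite -/((abse \o f) t) fune_abse funeneg_ge0/= leeDr.
rewrite /=.
have -> : \sum_(t <- X) a t = \sum_(t <- X) fine (f^\+%E t) - \sum_(t <- X) fine (f^\-%E t).
  rewrite -sumrB; apply: eq_bigr => t _.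
  rewrite funeposE funenegE /f -EFinN -!EFin_max/= !maxEle.
  by case: ifPn; case: ifPn; lra.
by rewrite ler_norml; lra.
Qed.


(** Take a finite set whose sum is within [e] of the supremum: any finite sum
    outside it can be added to that sum, so it is at most [e]. *)
Lemma sum_le_tail (T : choiceType) (a : T -> R) (e : R) :
  usummable a -> 0 < e -> exists X : {fset T}, sum_le (~` [set` X]) a e.
Proof.
rewrite /usummable summableE => sa e0.
pose M := fine (\esum_(t in setT) `|(a t)%:E|)%E.
have aM : sum_le setT a M by apply/sum_leP; rewrite fineK.
have [_ [X [finX _] <-] Xe] := ub_ereal_sup_adherent e0 sa.
have {}Xe : M - e < \sum_(t <- fset_set X) `|a t|.
  rewrite -lte_fin EFinB fineK// -sumEFin.
  by move: Xe; rewrite fsbig_finite.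
exists (fset_set X) => Y YX.
have XYE : perm_eq (fset_set X `|` Y)%fset (fset_set X ++ Y).
  apply: uniq_perm => [||t]; [exact: fset_uniq| |by rewrite mem_cat inE].
  rewrite cat_uniq !fset_uniq andbT/=.
  by apply/hasPn => t /YX/= /negP.
have /aM : [set` (fset_set X `|` Y)%fset] `<=` setT by [].
by rewrite (perm_big _ XYE) big_cat/=; lra.
Qed.

(** Convergence along finite sets determines the sum; linearity of [usum] is
    deduced from that of finite sums through this criterion. *)
Lemma usum_unique (T : choiceType) (a : T -> R) (S : R) : usummable a ->
  (forall e, 0 < e -> exists X : {fset T}, forall Y : {fset T},
     (X `<=` Y)%fset -> `|S - \sum_(t <- Y) a t| <= e) ->
  usum a = S.
Proof.
move=> sa aS; apply/eqP; rewrite -subr_eq0 -normr_le0.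
apply/ler_addgt0Pl => e e0; rewrite addr0.
have [|X XS] := aS (e / 2); first by rewrite divr_gt0.
have [|Y aY] := sum_le_tail sa (_ : 0 < e / 2); first by rewrite divr_gt0.
have XY : sum_le (~` [set` (X `|` Y)%fset]) a (e / 2).
  apply: sum_leW aY => // t; rewrite /= inE => /negP; rewrite negb_or.
  by case/andP=> _ /negP.
have := XS _ (fsubsetUl X Y); have := usum_approx sa XY.
by rewrite !ler_norml; lra.
Qed.

Lemma usummableZ (T : choiceType) (c : R) (a : T -> R) :
  usummable a -> usummable (fun t => c * a t).
Proof.
move=> /usummableP[M aM]; apply/usummableP.
by exists (`|c| * M); exact: sum_leZ.
Qed.

Lemma usummableB (T : choiceType) (a b : T -> R) :
  usummable a -> usummable b -> usummable (fun t => a t - b t).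
Proof.
move=> /usummableP[M aM] /usummableP[N bN]; apply/usummableP.
by exists (M + N); exact: sum_leB.
Qed.

Lemma usumB (T : choiceType) (a b : T -> R) :
  usummable a -> usummable b ->
  usum (fun t => a t - b t) = usum a - usum b.
Proof.
move=> sa sb; apply: usum_unique => [|e e0]; first exact: usummableB.
have [|X aX] := sum_le_tail sa (_ : 0 < e / 2); first by rewrite divr_gt0.
have [|Y bY] := sum_le_tail sb (_ : 0 < e / 2); first by rewrite divr_gt0.
exists (X `|` Y)%fset => Z; rewrite fsubUset => /andP[/fsubsetP XZ /fsubsetP YZ].
have /(usum_approx sa) : sum_le (~` [set` Z]) a (e / 2).
  by apply: sum_leW aX => // t /= tZ /XZ.
have /(usum_approx sb) : sum_le (~` [set` Z]) b (e / 2).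
  by apply: sum_leW bY => // t /= tZ /YZ.
by rewrite sumrB !ler_norml; lra.
Qed.

Lemma usumZ (T : choiceType) (c : R) (a : T -> R) :
  usummable a -> usum (fun t => c * a t) = c * usum a.
Proof.
move=> sa; apply: usum_unique => [|e e0]; first exact: usummableZ.
have c0 : 0 < `|c| + 1 by rewrite ltr_wpDl.
have [|X aX] := sum_le_tail sa (_ : 0 < e / (`|c| + 1)); first by rewrite divr_gt0.
exists X => Z /fsubsetP XZ.
have /(usum_approx sa) : sum_le (~` [set` Z]) a (e / (`|c| + 1)).
  by apply: sum_leW aX => // t /= tZ /XZ.
rewrite ler_pdivlMr// => h; apply: le_trans h.
rewrite -mulr_sumr -mulrBr normrM mulrC ler_wpM2l//.
by rewrite lerDl.
Qed.

Lemma usum_le (T : choiceType) (a : T -> R) (M : R) :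
  sum_le setT a M -> `|usum a| <= M.
Proof.
move=> aM; have sa : usummable a by apply/usummableP; exists M.
have := @usum_approx _ a fset0 M sa; rewrite big_seq_fset0 subr0; apply.
exact: sum_leW aM.
Qed.

(** Fubini for absolutely convergent double families, through the positive and
    negative parts, for which iterated and double sums always agree. *)
Lemma usum_pair (T1 T2 : choiceType) (a : T1 -> T2 -> R) :
  usummable (fun t : T1 * T2 => a t.1 t.2) ->
  [/\ forall i, usummable (a i),
      usummable (fun i => usum (a i)) &
      usum (fun i => usum (a i)) = usum (fun t : T1 * T2 => a t.1 t.2)].
Proof.
move=> sa.
have pairE (g : T1 -> T2 -> \bar R) : (forall i j, 0 <= g i j)%E ->
    (\esum_(t in setT) g t.1 t.2 = \esum_(i in setT) \esum_(j in setT) g i j)%E.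
  move=> g0; rewrite esum_esum//; congr (esum _ _).
  by apply/seteqP; split.
have rowlt (g : T1 -> T2 -> \bar R) : (forall i j, 0 <= g i j <= `|(a i j)%:E|)%E ->
    [/\ forall i j, (0 <= g i j)%E,
     forall i, (\esum_(j in setT) g i j)%E \is a fin_num &
     summable setT (fun i => \esum_(j in setT) g i j)%E].
  move=> ga; have g0 i j : (0 <= g i j)%E by case/andP: (ga i j).
  have H : (\esum_(i in setT) \esum_(j in setT) g i j < +oo)%E.
    rewrite -pairE//; apply: le_lt_trans sa; apply: le_esum => t _.
    by case/andP: (ga t.1 t.2).
  have S : summable setT (fun i => \esum_(j in setT) g i j)%E.
    rewrite /summable; apply: le_lt_trans H; apply: le_esum => i _.
    by rewrite gee0_abs// esum_ge0.
  split => // i; rewrite ge0_fin_numE ?esum_ge0//.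
  by have := summable_pinfty S (I : setT i); rewrite gee0_abs// esum_ge0.
have [_ absfin abssum] := rowlt (fun i j => `|(a i j)%:E|%E)
  (fun i j => introT andP (conj (abse_ge0 _) (lexx _))).
have sai i : usummable (a i) by rewrite /usummable summableE.
pose f i := fun j => (a i j)%:E.
have fp i j : (0 <= (f i)^\+ j <= `|(a i j)%:E|)%E.
  by rewrite -/((abse \o f i) j) fune_abse funepos_ge0/= leeDl.
have fn i j : (0 <= (f i)^\- j <= `|(a i j)%:E|)%E.
  by rewrite -/((abse \o f i) j) fune_abse funeneg_ge0/= leeDr.
have [p0 pfin psum] := rowlt (fun i => (f i)^\+%E) fp.
have [q0 qfin qsum] := rowlt (fun i => (f i)^\-%E) fn.
have rowE i : (usum (a i))%:E =
    ((fun i => \esum_(j in setT) (f i)^\+%E j) \-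
     (fun i => \esum_(j in setT) (f i)^\-%E j))%E i.
  by rewrite /usum fineK// fin_numB pfin qfin.
split=> //.
  rewrite /usummable; under eq_fun do rewrite rowE; exact: summableB.
rewrite {1}/usum; under eq_fun do rewrite rowE.
rewrite esumB// => [|i _|i _]; [|exact: esum_ge0|exact: esum_ge0].
rewrite -(pairE _ p0) -(pairE _ q0) /usum; congr (fine (_ - _)%E).
  by apply: eq_esum => t _; rewrite !funeposE.
by apply: eq_esum => t _; rewrite !funenegE.
Qed.

Lemma reindex_usum (T T' : choiceType) (e : T -> T') (a : T' -> R) :
  bijective e -> usum (fun t => a (e t)) = usum a.
Proof.
rewrite -setTT_bijective => eb.
rewrite /usum; congr (fine (_ - _)%E); rewrite (@reindex_esum _ _ _ _ _ _ _ eb);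
  apply: eq_esum => t _.
  by rewrite !funeposE.
by rewrite !funenegE.
Qed.

Lemma reindex_sum_le (T T' : choiceType) (e : T -> T') (a : T' -> R) (M : R) :
  bijective e -> sum_le setT (fun t => a (e t)) M <-> sum_le setT a M.
Proof.
rewrite -setTT_bijective => eb.
by rewrite !sum_leP (@reindex_esum _ _ _ _ _ _ _ eb).
Qed.

End usum.

(** * Series with locally uniform tails *)

Lemma ler_sum_subset (R : numDomainType) (T : eqType) (s s' : seq T) (a : T -> R) :
  (forall t, 0 <= a t) -> uniq s -> {subset s <= s'} ->
  \sum_(t <- s) a t <= \sum_(t <- s') a t.
Proof.
move=> a0; elim: s s' => [|x s IH] s' /=; first by rewrite big_nil sumr_ge0.
case/andP=> xs us ss'; have xs' : x \in s' by apply: ss'; rewrite mem_head.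
rewrite (perm_big _ (perm_to_rem xs')) !big_cons lerD2l; apply: IH => // y ys.
apply: rem_mem; last by apply: ss'; rewrite inE ys orbT.
by apply: contraNneq xs => <-.
Qed.

Section lus.
Variable R : realType.

(** The uniformity is only local: for a series of translates of a kernel, the
    tail beyond a finite set of indices is not small over the whole space, since
    every index is close to some point. *)
Definition loc_unif (T : choiceType) (V : topologicalType) (F : T -> V -> R) :=
  forall (z0 : V) (e : R), 0 < e -> exists X : {fset T},
    \forall z \near z0, sum_le (~` [set` X]) (F^~ z) e.

Lemma sum_le_split (T : choiceType) (a : T -> R) (X : {fset T}) (e : R) :
  sum_le (~` [set` X]) a e -> sum_le setT a (\sum_(t <- X) `|a t| + e).
Proof.
move=> ae Y _; rewrite (bigID (mem X))/=; apply: lerD.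
  rewrite big_fset_condE/=.
  apply: (ler_sum_subset (a := fun i => `|a i|)) => //.
  by move=> t; rewrite !inE => /andP[].
rewrite big_fset_condE/=; apply: ae => t /=.
by rewrite !inE => /andP[_ /negP].
Qed.

Lemma loc_unif_summable (T : choiceType) (V : topologicalType) (F : T -> V -> R) z :
  loc_unif F -> usummable (F^~ z).
Proof.
move=> /(_ z 1 ltr01)[X /nbhs_singleton FX]; apply/usummableP.
by exists (\sum_(t <- X) `|F t z| + 1); exact: sum_le_split.
Qed.

Lemma loc_unif_sum (T : choiceType) (V : topologicalType) (I : Type) (r : seq I)
    (F : I -> T -> V -> R) :
  (forall i, loc_unif (F i)) -> loc_unif (fun t z => \sum_(i <- r) F i t z).
Proof.
move=> Fu; elim: r => [|i r IH] z e e0.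
  by exists fset0; near=> z' => Y _; rewrite big1 ?ltW// => t _; rewrite big_nil normr0.
have [|X FX] := Fu i z (e / 2); first by rewrite divr_gt0.
have [|Y FY] := IH z (e / 2); first by rewrite divr_gt0.
exists (X `|` Y)%fset; near=> z'.
have h1 : sum_le (~` [set` (X `|` Y)%fset]) (F i ^~ z') (e / 2).
  have : sum_le (~` [set` X]) (F i ^~ z') (e / 2) by near: z'.
  by apply: sum_leW => // t /= tXY tX; apply: tXY; rewrite inE tX.
have h2 : sum_le (~` [set` (X `|` Y)%fset]) (fun t => \sum_(i <- r) F i t z') (e / 2).
  have : sum_le (~` [set` Y]) (fun t => \sum_(i <- r) F i t z') (e / 2) by near: z'.
  by apply: sum_leW => // t /= tXY tX; apply: tXY; rewrite inE tX orbT.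
have := sum_leD h1 h2; rewrite -splitr; apply: sum_leW => // t _.
by rewrite big_cons.
Unshelve. all: by end_near. Qed.

Lemma loc_unif_comp (T : choiceType) (V W : topologicalType) (F : T -> V -> R)
    (g : W -> V) :
  continuous g -> loc_unif F -> loc_unif (fun t w => F t (g w)).
Proof.
move=> cg Fu w e e0; have [X FX] := Fu (g w) e e0.
by exists X; exact: (cg w _ FX).
Qed.

Lemma loc_unif_continuous (T : choiceType) (V : topologicalType) (F : T -> V -> R) :
  loc_unif F -> (forall t, continuous (F t)) ->
  continuous (fun z => usum (F^~ z)).
Proof.
move=> Fu cF z; apply/cvgrPdist_le => e e0.
have [|X FX] := Fu z (e / 3); first by rewrite divr_gt0.
have cX : continuous (fun z => \sum_(t <- X) F t z).
  move=> y; apply: cvg_big => //=; [|by move=> t _; exact: cF].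
  by move=> [a b]; exact: add_continuous.
have cXz : \forall z' \near z, `|\sum_(t <- X) F t z - \sum_(t <- X) F t z'| <= e / 3.
  have /cvgrPdist_le := cX z; apply; by rewrite divr_gt0.
have FXz := nbhs_singleton FX.
near=> z'.
have h1 : sum_le (~` [set` X]) (F^~ z') (e / 3) by near: z'.
have h2 : `|\sum_(t <- X) F t z - \sum_(t <- X) F t z'| <= e / 3 by near: z'.
have := usum_approx (loc_unif_summable z Fu) FXz.
have := usum_approx (loc_unif_summable z' Fu) h1.
by move: h2; rewrite !ler_norml; lra.
Unshelve. all: by end_near. Qed.

Lemma is_derive_sum_seq (T : Type) (s : seq T) (c : T -> R) (F : T -> R -> R)
    (F' : T -> R) (x : R) :
  (forall t, is_derive x 1 (F t) (F' t)) ->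
  is_derive x 1 (fun y => \sum_(t <- s) c t * F t y) (\sum_(t <- s) c t * F' t).
Proof.
move=> dF; elim: s => [|t s IH].
  under [X in is_derive _ _ X _]eq_fun do rewrite big_nil.
  by rewrite big_nil; exact: is_derive_cst.
under [X in is_derive _ _ X _]eq_fun do rewrite big_cons.
rewrite big_cons; exact: is_deriveD.
Qed.

Lemma MVT_quotient (G G' : R -> R) (x h : R) : h != 0 ->
  (forall y : R, is_derive y 1 G (G' y)) ->
  exists2 xi, `|xi - x| <= `|h| & h^-1 * (G (h + x) - G x) = G' xi.
Proof.
move=> h0 dG.
have cG : continuous G.
  by move=> y; apply/differentiable_continuous/derivable1_diffP/ex_derive.
have mvt a b : a <= b -> exists2 c, a <= c <= b & G b - G a = G' c * (b - a).
  move=> ab; have [|c cab ->] := @MVT_segment R G G' a b ab _.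
  - by apply: continuous_subspaceT.
  - by exists c.
have [hp|hn] := ltP 0 h.
  have [c /andP[c1 c2] E] := mvt x (h + x) ltac:(lra).
  exists c; first by rewrite ger0_norm ?gtr0_norm//; lra.
  by rewrite E addrK mulrC mulfK.
have [c /andP[c1 c2] E] := mvt (h + x) x ltac:(lra).
exists c; first by rewrite ler0_norm ?ler0_norm//; lra.
rewrite -(opprB (G x)) E mulrN opprD addrC.
by field.
Qed.


(** The tail of the difference quotients is controlled by the tail of the
    derivatives.  Each finite partial sum of absolute values is a sum with fixed
    signs, hence a difference quotient of one function; the mean value theorem
    then provides a single intermediate point common to all its terms. *)
Lemma loc_unif_derive (T : choiceType) (F F' : T -> R -> R) (x : R) :
  loc_unif F -> loc_unif F' ->
  (forall t (y : R), is_derive y 1 (F t) (F' t y)) ->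
  is_derive x 1 (fun y => usum (F^~ y)) (usum (F'^~ x)).
Proof.
move=> Fu F'u dF.
suff H : (fun h => h^-1 *: (((fun y => usum (F^~ y)) \o shift x) (h *: 1) -
    usum (F^~ x))) @ 0^' --> usum (F'^~ x).
  by apply: DeriveDef; [exact: cvgP H|exact: cvg_lim H].
apply/cvgrPdist_le => e e0.
have [|X FX] := F'u x (e / 3); first by rewrite divr_gt0.
have F'x := nbhs_singleton FX.
have [r /= r0 Xr] := (nbhs_ballP _ _).1 FX.
pose quot h t := h^-1 * (F t (h + x) - F t x).
have quotX h : h != 0 -> `|h| < r -> sum_le (~` [set` X]) (quot h) (e / 3).
  move=> h0 hr Y YX.
  have [|xi xix xiE] := @MVT_quotient
      (fun y => \sum_(t <- Y) Num.sg (quot h t) * F t y)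
      (fun y => \sum_(t <- Y) Num.sg (quot h t) * F' t y) x h h0.
    by move=> y; exact: is_derive_sum_seq.
  have -> : \sum_(t <- Y) `|quot h t| = \sum_(t <- Y) Num.sg (quot h t) * F' t xi.
    rewrite -xiE -sumrB mulr_sumr; apply: eq_bigr => t _.
    by rewrite normrEsg -mulrBr mulrCA.
  have : sum_le (~` [set` X]) (F'^~ xi) (e / 3).
    by apply: Xr; rewrite /ball/= distrC; exact: le_lt_trans xix hr.
  move=> /(_ Y YX); apply: le_trans; apply: ler_sum => t _.
  apply: le_trans (ler_norm _) _; rewrite normrM.
  by rewrite ler_piMl// normr_sg lern1 leq_b1.
have quot_lim : (fun h => \sum_(t <- X) quot h t) @ 0^' --> \sum_(t <- X) F' t x.
  have := is_derive_sum_seq X (fun=> 1) (fun t => dF t x).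
  move=> [dX]; rewrite [X in _ = X](eq_bigr (F'^~ x)) => [dXE|t _]; last by rewrite mul1r.
  rewrite -dXE; move: dX; apply: cvg_trans.
  apply: near_eq_cvg; near=> h.
  rewrite /= -sumrB scaler_sumr; apply: eq_bigr => t _.
  by rewrite /quot !mul1r [h *: 1]mulr1.
have {}quot_lim : \forall h \near 0^',
    `|\sum_(t <- X) F' t x - \sum_(t <- X) quot h t| <= e / 3.
  by move/cvgrPdist_le : quot_lim; apply; rewrite divr_gt0.
near=> h.
have h0 : h != 0 by near: h; exact: nbhs_dnbhs_neq.
have hr : `|h| < r.
  by near: h; apply: dnbhs0_lt.
have hX : `|\sum_(t <- X) F' t x - \sum_(t <- X) quot h t| <= e / 3 by near: h.
rewrite [h *: 1]mulr1 /=.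
have sF y : usummable (F^~ y) := loc_unif_summable y Fu.
have sF' : usummable (F'^~ x) := loc_unif_summable x F'u.
have squot : usummable (quot h) by apply/usummableZ/usummableB.
have -> : h^-1 *: (usum (F^~ (h + x)) - usum (F^~ x)) = usum (quot h).
  by rewrite /quot usumZ ?usumB//; exact: usummableB.
have := usum_approx sF' F'x; have := usum_approx squot (quotX h h0 hr).
by move: hX; rewrite !ler_norml; lra.
Unshelve. all: by end_near. Qed.

End lus.

(** * Sums of products over multi-indices *)

Section product_sums.
Variables (R : realType) (J : finType) (S : choiceType).
Implicit Types (h : J -> S -> R) (K : seq S).

Definition ffun_box K : seq {ffun J -> S} :=
  [seq [ffun c => tnth (in_tuple K) (f c)] |
    f : {ffun J -> 'I_(size K)} <- enum {: {ffun J -> 'I_(size K)}}].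

Lemma mem_ffun_box K (kappa : {ffun J -> S}) :
  (forall c, kappa c \in K) -> kappa \in ffun_box K.
Proof.
move=> kK; have /= iK c := seq_tnthP (kK c).
apply/mapP; exists [ffun c => sval (iK c)]; first by rewrite mem_enum.
by apply/ffunP => c; rewrite !ffunE; case: (iK c).
Qed.

Lemma sum_ffun_box h K :
  \sum_(kappa <- ffun_box K) \prod_c h c (kappa c) = \prod_c \sum_(k <- K) h c k.
Proof.
rewrite big_map big_enum/=.
under [RHS]eq_bigr do rewrite big_tnth.
rewrite bigA_distr_bigA/=; apply: eq_bigr => f _; apply: eq_bigr => c _.
by rewrite ffunE.
Qed.

(** Finitely many multi-indices lie in a box, and over a box the sum of the
    products is the product of the sums. *)
Lemma sum_le_prod h (M : J -> R) : (forall c, sum_le setT (h c) (M c)) ->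
  sum_le [set: {ffun J -> S}] (fun kappa => \prod_c h c (kappa c)) (\prod_c M c).
Proof.
move=> hM X _; pose K := [fset (kappa : {ffun J -> S}) c | kappa in X, c in J]%fset.
apply: (@le_trans _ _ (\sum_(kappa <- ffun_box K) \prod_c `|h c (kappa c)|)).
  under eq_bigr do rewrite normr_prod.
  apply: (ler_sum_subset (a := fun kappa : {ffun J -> S} => \prod_c `|h c (kappa c)|)) => //.
  - by move=> kappa; apply: prodr_ge0.
  - exact: fset_uniq.
  - move=> kappa kX; apply: mem_ffun_box => c.
    by apply/imfset2P; exists kappa => //; exists c.
rewrite (sum_ffun_box (fun c k => `|h c k|)); apply: ler_prod => c _.
by rewrite sumr_ge0//=; apply: hM.
Qed.

(** A multi-index outside the box has an entry outside [K]; the corresponding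
    factor then contributes its tail, and the other factors their full sums. *)
Lemma sum_le_prod_tail h K (M delta : R) :
  (forall c, sum_le setT (h c) M) ->
  (forall c, sum_le (~` [set` K]) (h c) delta) ->
  sum_le (~` [set` [fset kappa in ffun_box K]%fset])
    (fun kappa => \prod_c h c (kappa c)) ((\sum_(c : J) M ^+ #|J|.-1) * delta).
Proof.
move=> hM hK Y YK.
pose h' c c' k := if c' == c then (if k \in K then 0 else h c k) else h c' k.
have h'M c : sum_le [set: {ffun J -> S}] (fun kappa => \prod_c' h' c c' (kappa c'))
    (M ^+ #|J|.-1 * delta).
  have -> : M ^+ #|J|.-1 * delta = \prod_c' (if c' == c then delta else M).
    rewrite (bigD1 c)//= eqxx mulrC; congr (_ * _).
    rewrite (eq_bigr (fun=> M)) => [|c' /negPf -> //].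
    by rewrite prodr_const cardC1.
  apply: sum_le_prod => c'; rewrite /h'; case: eqP => [_|_]; last exact: hM.
  move=> Z _; rewrite (bigID (mem K))/= big1 ?add0r => [|k ->]; last by rewrite normr0.
  rewrite big_fset_condE/= big_seq.
  rewrite (eq_bigr (fun k => `|h c k|)) => [|k]; last first.
    by rewrite !inE => /andP[_ /negPf ->].
  rewrite -big_seq; apply: hK => k /=.
  by rewrite !inE => /andP[_ /negP].
rewrite mulr_suml; apply: le_trans (ler_sum _ (fun c _ => h'M c Y (@subsetT _ _))).
rewrite exchange_big/= big_seq [leRHS]big_seq; apply: ler_sum => kappa kY.
have [c kc] : exists c, kappa c \notin K.
  apply: contrapT => kK; apply: (YK kappa kY); rewrite /= inE.
  apply: mem_ffun_box => c; apply/negPn/negP => kc; apply: kK.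
  by exists c.
rewrite [leRHS](bigD1 c)//=.
rewrite (_ : \prod_c' h' c c' (kappa c') = \prod_c' h c' (kappa c')); last first.
  by apply: eq_bigr => c' _; rewrite /h'; case: eqP => // ->; rewrite (negPf kc).
by rewrite lerDl sumr_ge0.
Qed.

End product_sums.

(** * Kernels with uniform tails *)

Section tails.
Variable R : realType.
Implicit Types g h : R -> R.

Definition unif_tails (n : nat) g := forall e : R, 0 < e ->
  exists r : R, forall u : R,
    sum_le [set k : int | r <= `|u - k%:~R|] (fun k => `|u - k%:~R| ^+ n * g (u - k%:~R)) e.

Lemma moment_unif_tails n g : moment_cvg_unif n g -> unif_tails n g.
Proof.
move=> [_ +] e e0.
set T := (fun r : R => ereal_sup _) => /fine_cvgP[Tfin /cvgr0Pnorm_le Tcvg].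
have {}Tcvg := Tcvg e e0.
near (@pinfty_nbhs R) => r; exists r => u; apply/sum_leP.
have Tr : T r \is a fin_num by near: r.
have Te : `|fine (T r)| <= e by near: r.
apply: (@le_trans _ _ (T r)).
  have : (\esum_(k in [set k : int | (r <= `|u - k%:~R|)%R])
      (`|u - k%:~R| ^+ n * `|g (u - k%:~R)|)%:E <= T r)%E.
    by apply: ereal_sup_ubound; exists u.
  apply: le_trans; apply: le_esum => k _.
  by rewrite lee_fin normrM normrX normr_id.
by rewrite -(fineK Tr) lee_fin; exact: le_trans (ler_norm _) Te.
Unshelve. all: by end_near. Qed.

Lemma unif_tails_le m n g : (m <= n)%N -> unif_tails n g -> unif_tails m g.
Proof.
move=> mn gn e e0; have [r gr] := gn e e0.
(* Beyond distance 1 a lower power is dominated by a higher one. *)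
exists (Num.max r 1) => u.
apply: sum_leW (gr u) => // k /=; rewrite ge_max => /andP[]// rk k1.
by rewrite !normrM ler_wpM2r// !normrX !normr_id ler_weXn2l.
Qed.

Lemma unif_tailsD n g h : unif_tails n g -> unif_tails n h ->
  unif_tails n (fun x => g x + h x).
Proof.
move=> gn hn e e0.
have [|r gr] := gn (e / 2); first by rewrite divr_gt0.
have [|s hs] := hn (e / 2); first by rewrite divr_gt0.
exists (Num.max r s) => u.
have h1 : sum_le [set k : int | Num.max r s <= `|u - k%:~R|]
    (fun k => `|u - k%:~R| ^+ n * g (u - k%:~R)) (e / 2).
  by apply: sum_leW (gr u) => // k /=; rewrite ge_max => /andP[].
have h2 : sum_le [set k : int | Num.max r s <= `|u - k%:~R|]
    (fun k => `|u - k%:~R| ^+ n * h (u - k%:~R)) (e / 2).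
  by apply: sum_leW (hs u) => // k /=; rewrite ge_max => /andP[].
have := sum_leD h1 h2; rewrite -splitr; apply: sum_leW => // k _.
by rewrite mulrDr.
Qed.

Lemma unif_tailsZ n (c : R) g : unif_tails n g -> unif_tails n (fun x => c * g x).
Proof.
move=> gn e e0; have c0 : 0 < `|c| + 1 by rewrite ltr_wpDl.
have [|r gr] := gn (e / (`|c| + 1)); first by rewrite divr_gt0.
exists r => u; have := sum_leZ c (gr u); apply: sum_leW => // [k _|].
  by rewrite mulrCA.
rewrite mulrA ler_pdivrMr// [leRHS]mulrC.
by apply: ler_wpM2r; [exact: ltW|rewrite lerDl].
Qed.

Lemma unif_tailsX n g : unif_tails n.+1 g -> unif_tails n (fun x => x * g x).
Proof.
move=> gn e e0; have [r gr] := gn e e0; exists r => u.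
apply: sum_leW (gr u) => // k _.
by rewrite !normrM exprSr normrM normr_id mulrA.
Qed.

Lemma finite_int_ball (r : R) :
  exists K : seq int, forall k, k \notin K -> r <= `|k%:~R : R|.
Proof.
pose N := (Num.truncn `|r|).+1.
exists ([seq Posz i | i <- iota 0 N] ++ [seq Negz i | i <- iota 0 N]) => k kN.
have rN : r <= N%:R.
  exact: le_trans (ler_norm _) (ltW (truncnS_gt _)).
apply: le_trans rN _; rewrite -intr_norm.
suff : (N <= `|k|)%N by rewrite -(ler_nat R) -abszE.
rewrite leqNgt; apply: contra kN => kN; rewrite mem_cat.
case: k kN => k kN; apply/orP; [left|right]; apply: map_f; rewrite mem_iota/= add0n//.
exact: ltnW.
Qed.

(** The sum is periodic in [u], so that the maximum over a compact period
    bounds it everywhere. *)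
Lemma unif_tails_bounded g : continuous g -> unif_tails 0 g ->
  exists M : R, forall u : R, sum_le setT (fun k : int => g (u - k%:~R)) M.
Proof.
move=> cg /(_ 1 ltr01)[r gr].
have [K0 farK] := finite_int_ball (r + 1).
pose K := [fset k in K0]%fset.
have cgk (a : R) : continuous (fun u : R => `|g (u - a)|).
  move=> u; apply: cvg_norm.
  apply: (@continuous_comp R R R (fun u => u - a) g); last exact: cg.
  by apply: cvgB; [exact: cvg_id|exact: cvg_cst].
have cS : {within `[0, 1], continuous (fun u : R => \sum_(k <- K) `|g (u - k%:~R)|)}.
  apply: continuous_subspaceT => u.
  apply: cvg_big => [|k _]; [exact: add_continuous|exact: cgk].
have [c _ cmax] := EVT_max ler01 cS.
exists (\sum_(k <- K) `|g (c - k%:~R)| + 1) => u.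
pose j := Num.floor u.
have bj : bijective (fun k : int => k + j).
  by exists (fun k => k - j) => k; rewrite ?addrK ?subrK.
rewrite -(reindex_sum_le (fun k : int => g (u - k%:~R)) _ bj).
pose v := u - j%:~R.
have v01 : 0 <= v <= 1.
  by have := floor_itv u; rewrite -/j intrD /v; lra.
have gv : sum_le (~` [set` K]) (fun k : int => g (v - k%:~R)) 1.
  apply: sum_leW (gr v) => // k /=; last by rewrite expr0 mul1r.
  rewrite inE => /negP /farK kN.
  have h3 : `|k%:~R : R| <= `|v - k%:~R| + `|v|.
    by rewrite addrC; have := ler_normB v (v - k%:~R); rewrite subKr.
  have h4 : `|v| <= 1 by rewrite ger0_norm; case/andP: v01.
  lra.
have := sum_le_split gv; apply: sum_leW => // [k _|].
  by rewrite intrD /v opprD addrCA addrC.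
by rewrite lerD2r; apply: cmax; rewrite in_itv.
Qed.

End tails.

Section smooth_kernels.
Variable R : realType.

Definition smooth_tails (p n : nat) (g : R -> R) : Prop :=
  (forall q, (q < p)%N -> forall x : R, derivable (derive1n q g) x 1) /\
  (forall q, (q <= p)%N -> continuous (derive1n q g) /\ unif_tails n (derive1n q g)).

Lemma smooth_tails_le p m n g : (m <= n)%N -> smooth_tails p n g -> smooth_tails p m g.
Proof.
move=> mn [dg cg]; split=> // q qp; have [c t] := cg q qp; split=> //.
exact: unif_tails_le t.
Qed.

(** At order 0 the second summand vanishes through its coefficient, so that the
    truncated predecessor there is harmless. *)
Lemma derive1n_mulx p (g : R -> R) :
  (forall q, (q < p)%N -> forall x : R, derivable (derive1n q g) x 1) ->
  forall q, (q <= p)%N -> derive1n q (fun x => x * g x) =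
    (fun x => x * derive1n q g x + q%:R * derive1n q.-1 g x).
Proof.
move=> dg; elim=> [|q IH] qp.
  by apply/funext => x; rewrite !derive1n0 mul0r addr0.
rewrite [LHS]derive1nS (IH (ltnW qp)); apply/funext => x; rewrite derive1E.
have dq := dg q qp x.
have d1 : is_derive x 1 (derive1n q g) (derive1n q.+1 g x).
  by rewrite derive1nS derive1E; exact: derivableP.
have d2 : is_derive x 1 (fun x => q%:R * derive1n q.-1 g x) (q%:R * derive1n q g x).
  case: (q) d1 qp => [|q'] d1 qp.
    under [X in is_derive _ _ X _]eq_fun do rewrite mul0r.
    by rewrite mul0r; exact: is_derive_cst.
  have : is_derive x 1 (derive1n q' g) (derive1n q'.+1 g x).
    by rewrite derive1nS derive1E; apply: derivableP; apply: dg; exact: ltnW.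
  by move=> ?; exact: is_deriveZ.
have d3 : is_derive x 1 (fun x => x * derive1n q g x)
    (x * derive1n q.+1 g x + derive1n q g x).
  have := @is_deriveM _ _ (@idfun R) (derive1n q g) x 1 1 _ _ d1.
  by rewrite /GRing.scale/= mulr1; exact.
have /@derive_val -> := is_deriveD d3 d2.
rewrite -addrA; congr (_ + _).
by rewrite -(addn1 q) natrD mulrDl mul1r addrC addn1.
Qed.

(** One moment is spent on the factor [x] in front of the derivative of [g]; the
    other summand of the product rule needs no more than [g] itself provides. *)
Lemma smooth_tails_mulx p n g : smooth_tails p n.+1 g ->
  smooth_tails p n (fun x => x * g x).
Proof.
move=> [dg cg]; have dE := derive1n_mulx dg; split=> q qp.
  rewrite (dE q (ltnW qp)) => x.
  apply: derivableD; first by apply: derivableM; [exact: derivable_id|exact: dg].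
  by apply: derivableZ; apply: dg; exact: leq_ltn_trans (leq_pred q) qp.
rewrite (dE q qp).
have [cq tq] := cg q qp; have [cq' tq'] := cg q.-1 (leq_trans (leq_pred q) qp).
split.
  move=> x; apply: cvgD; first by apply: cvgM; [exact: cvg_id|exact: cq].
  by apply: cvgM; [exact: cvg_cst|exact: cq'].
apply: unif_tailsD; first exact: unif_tailsX.
by apply: unif_tailsZ; exact: unif_tails_le tq'.
Qed.

Lemma smooth_tails_monomial p n a g : (a <= n)%N -> smooth_tails p n g ->
  smooth_tails p 0 (fun x => x ^+ a * g x).
Proof.
move=> an /(smooth_tails_le an) {an}.
elim: a => [|a IH] in g *.
  by under [X in _ -> smooth_tails _ _ X]eq_fun do rewrite expr0 mul1r.
move=> /smooth_tails_mulx /IH.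
by under eq_fun do rewrite mulrA -exprSr.
Qed.

End smooth_kernels.

(** * Termwise directional derivatives *)

Section directional.
Variables (R : realType) (V : normedModType R).

(** Both sides are limits of the same difference quotient, so that directional
    derivatives can be computed for functions of one real variable. *)
Lemma is_derive_line (f : V -> R) (v z : V) (y D : R) :
  is_derive (y *: v + z) v f D <-> is_derive y 1 (fun h : R => f (h *: v + z)) D.
Proof.
have E : (fun h : R => h^-1 *: ((f \o shift (y *: v + z)) (h *: v) - f (y *: v + z))) =
    (fun h : R => h^-1 *: (((fun h : R => f (h *: v + z)) \o shift y) (h *: 1) -
       f (y *: v + z))).
  by apply/funext => h; rewrite /= [h *: 1]mulr1 addrA scalerDl.
have cast (P Q : Prop) : P = Q -> P -> Q by move=> ->.
have Ed : derivable f (y *: v + z) v = derivable (fun h : R => f (h *: v + z)) y 1 :=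
  congr1 (fun q : R -> R => cvg (q @ (0 : R)^')) E.
have Ee : 'D_v f (y *: v + z) = 'D_1 (fun h : R => f (h *: v + z)) y :=
  congr1 (fun q : R -> R => lim (q @ (0 : R)^')) E.
split=> -[d e]; split; first exact: (cast _ _ Ed d).
- exact: etrans (esym Ee) e.
- exact: (cast _ _ (esym Ed) d).
- exact: etrans Ee e.
Qed.

Lemma is_derive_line0 (f : V -> R) (v z : V) (D : R) :
  is_derive z v f D <-> is_derive (0 : R) 1 (fun h : R => f (h *: v + z)) D.
Proof. by have := is_derive_line f v z 0 D; rewrite scale0r add0r. Qed.

Lemma loc_unif_derive_dir (T : choiceType) (F F' : T -> V -> R) (v z : V) :
  loc_unif F -> loc_unif F' ->
  (forall t z, is_derive z v (F t) (F' t z)) ->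
  is_derive z v (fun y => usum (F^~ y)) (usum (F'^~ z)).
Proof.
move=> Fu F'u dF; apply/is_derive_line0.
have -> : usum (F'^~ z) = usum (fun t => F' t (0 *: v + z)) by rewrite scale0r add0r.
have line : continuous (fun h : R => h *: v + z).
  move=> h; apply: cvgD; last exact: cvg_cst.
  by apply: cvgZr_tmp; exact: cvg_id.
apply: (loc_unif_derive (F := fun t (h : R) => F t (h *: v + z))
                        (F' := fun t (h : R) => F' t (h *: v + z))).
- exact: (loc_unif_comp line Fu).
- exact: (loc_unif_comp line F'u).
- by move=> t y; apply/is_derive_line.
Qed.

End directional.

(** * Sampling series *)

Section sampling.
Variables (R : realType) (d : nat).
Local Notation V := (R * 'rV[R]_d)%type.
Local Notation J := (option 'I_d).
Local Notation K := ({ffun J -> int}).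

(** One function for both kinds of coordinates, dual to the directions [cdir]:
    the kernel in [x] then becomes one factor of a product over [option 'I_d]. *)
Definition coord (c : J) (z : V) : R := if c is Some i then z.2 0 i else z.1.

Lemma coord_continuous_pair (c : J) : continuous (coord c).
Proof.
case: c => [i|] z /=; last exact: cvg_fst.
apply: (@continuous_comp _ _ _ snd (fun y : 'rV[R]_d => y 0 i)); first exact: cvg_snd.
exact: coord_continuous.
Qed.

Lemma coord_line (c c0 : J) (h : R) (z : V) :
  coord c (h *: cdir R c0 + z) = coord c z + (c == c0)%:R * h.
Proof.
case: c c0 => [i|] [i0|] /=; rewrite ?mxE ?mulr1 ?mulr0 ?mul0r ?add0r ?addr0 ?mul1r//.
- by rewrite eqxx/= addrC mulrC.
- by rewrite scaler0 add0r.
- by rewrite [h *: 1]mulr1 addrC.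
Qed.

Definition sampling_term (w : R) (b : K -> R) (g : J -> R -> R) (kappa : K) (z : V) : R :=
  b kappa * \prod_c g c (w * coord c z - (kappa c)%:~R).

Section bounded_coefficients.
Variables (w CB : R) (b : K -> R) (g : J -> R -> R).
Hypothesis bC : forall kappa, `|b kappa| <= CB.
Hypothesis cg : forall c, continuous (g c).
Hypothesis tg : forall c, unif_tails 0 (g c).

Let CB0 : 0 <= CB.
Proof. exact: le_trans (normr_ge0 _) (bC [ffun=> 0]). Qed.

Lemma unif_tails_bounded_all :
  exists M : R, forall c u, sum_le setT (fun k : int => g c (u - k%:~R)) M.
Proof.
pose M c := sval (cid (unif_tails_bounded (cg (c:=c)) (tg c))).
have MP c u : sum_le setT (fun k : int => g c (u - k%:~R)) (M c).
  by rewrite /M; case: cid.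
exists (\sum_c M c) => c u; apply: sum_leW (MP c u) => //.
rewrite (bigD1 c)//= lerDl sumr_ge0// => c' _; exact: sum_le_ge0 (MP c' 0).
Qed.

Lemma sampling_term_continuous kappa : continuous (sampling_term w b g kappa).
Proof.
move=> z; apply: cvgM; first exact: cvg_cst.
apply: cvg_big => //=; first by move=> [x y]; exact: mul_continuous.
move=> c _; apply: (@continuous_comp _ _ _
  (fun z => w * coord c z - (kappa c)%:~R) (g c)); last exact: cg.
apply: cvgB; last exact: cvg_cst.
by apply: cvgM; [exact: cvg_cst|exact: coord_continuous_pair].
Qed.

Lemma sampling_term_le : exists M : R, forall z,
  sum_le setT (fun kappa => sampling_term w b g kappa z) M.
Proof.
have [M gM] := unif_tails_bounded_all.
exists (`|CB| * \prod_(c : J) M) => z.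
have := @sum_le_prod _ _ _ (fun c (k : int) => g c (w * coord c z - k%:~R)) (fun=> M)
  (fun c => gM c _).
move=> /(sum_leZ CB); apply: sum_leW => // kappa _.
by rewrite !normrM ler_wpM2r// (ger0_norm CB0).
Qed.

(** Near [z0] the numbers [w z_c] stay within distance 1 of their values at [z0],
    so the integers outside a single finite set [B] are at distance at least
    [r c] from [w z_c], for every [c] and every such [z]. *)
Lemma sampling_term_loc_unif : loc_unif (sampling_term w b g).
Proof.
move=> z0 e e0; have [M gM] := unif_tails_bounded_all.
pose C := CB * \sum_(c : J) M ^+ #|{: J}|.-1.
have C0 : 0 <= C.
  rewrite mulr_ge0// sumr_ge0// => c _; rewrite exprn_ge0//.
  exact: sum_le_ge0 (gM None 0).
(* The product of the tail [delta] with the full sums has to stay below [e]. *)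
pose delta := e / (C + 1).
have delta0 : 0 < delta by rewrite divr_gt0// ltr_wpDl.
pose r c := sval (cid (tg c delta0)).
have rP c u : sum_le [set k : int | r c <= `|u - k%:~R|] (fun k => g c (u - k%:~R)) delta.
  rewrite /r; case: cid => rc /= /(_ u); apply: sum_leW => // k _.
  by rewrite expr0 mul1r.
have [B farB] := finite_int_ball (\sum_c (`|r c| + `|w * coord c z0| + 1)).
have NP c : `|r c| + `|w * coord c z0| + 1 <= \sum_c (`|r c| + `|w * coord c z0| + 1).
  rewrite [leRHS](bigD1 c)//= lerDl sumr_ge0//.
exists [fset kappa in ffun_box _ B]%fset.
have nzc c : \forall z \near z0, `|w * coord c z0 - w * coord c z| <= 1.
  have : (fun z => w * coord c z) @ z0 --> w * coord c z0.
    by apply: cvgM; [exact: cvg_cst|exact: coord_continuous_pair].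
  by move=> /cvgrPdist_le/(_ 1 ltr01).
have nz := filter_forall (nbhs_filter z0) nzc.
near=> z.
have zP c : `|w * coord c z0 - w * coord c z| <= 1 by move: c; near: z.
have hK c : sum_le (~` [set` B]) (fun k : int => g c (w * coord c z - k%:~R)) delta.
  apply: sum_leW (rP c (w * coord c z)) => // k /= /negP /farB kN.
  have := NP c; have := zP c; have := ler_norm (r c).
  have := ler_normB (w * coord c z) (w * coord c z - k%:~R).
  rewrite subKr.
  have := ler_normB (w * coord c z0) (w * coord c z0 - w * coord c z).
  rewrite subKr.
  lra.
have := sum_le_prod_tail (fun c => gM c (w * coord c z)) hK.
move=> /(sum_leZ CB); apply: sum_leW => // [kappa _|].
  by rewrite !normrM ler_wpM2r// (ger0_norm CB0).
rewrite (ger0_norm CB0) mulrA -/C /delta mulrA ler_pdivrMr ?ltr_wpDl// mulrC.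
by rewrite ler_pM2l// lerDl.
Unshelve. all: by end_near. Qed.

End bounded_coefficients.

(** Along a line in the direction [c0] only the factor of index [c0] varies. *)
Lemma is_derive_sampling_term w b (g : J -> R -> R) (c0 : J) kappa z :
  (forall x : R, derivable (g c0) x 1) ->
  is_derive z (cdir R c0) (sampling_term w b g kappa)
    (w * sampling_term w b (fun c => if c == c0 then derive1 (g c) else g c) kappa z).
Proof.
move=> dg; apply/is_derive_line0.
pose P := \prod_(c | c != c0) g c (w * coord c z - (kappa c)%:~R).
pose x0 := w * coord c0 z - (kappa c0)%:~R.
have -> : (fun h : R => sampling_term w b g kappa (h *: cdir R c0 + z)) =
    (fun h => (b kappa * P) * (g c0 \o (fun h => w * h + x0)) h).
  apply/funext => h; rewrite /sampling_term (bigD1 c0)//= mulrAC -mulrA; congr (_ * (_ * _)).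
    by rewrite coord_line eqxx mul1r /x0 mulrDr -addrA addrCA.
  by apply: eq_bigr => c /negPf cc0; rewrite coord_line cc0 mul0r addr0.
have d1 : is_derive (0 : R) 1 (fun h : R => w * h + x0) w.
  have d0 : is_derive (0 : R) 1 (fun h : R => w * h) w.
    have := @is_deriveZ _ _ _ (@idfun R) w (0 : R) 1 1 _.
    by rewrite [w *: 1]mulr1; apply.
  by have := is_deriveD d0 (is_derive_cst x0 (0 : R) (1 : R)); rewrite addr0.
have d2 : is_derive (w * 0 + x0) 1 (g c0) (derive1 (g c0) x0).
  by rewrite mulr0 add0r derive1E; apply: derivableP; exact: dg.
have d3 := @is_derive1_comp _ (g c0) (fun h : R => w * h + x0) 0 _ _ d2 d1.
have := @is_deriveZ _ _ _ _ (b kappa * P) _ _ _ d3.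
congr (is_derive _ _ _ _).
rewrite /sampling_term (bigD1 c0)//= eqxx.
rewrite (eq_bigr (fun c => g c (w * coord c z - (kappa c)%:~R))); last first.
  by move=> c /negPf ->.
rewrite -/P -/x0 /GRing.scale/=; ring.
Qed.

(** The terms obtained by formal differentiation along the word [s]: the factor
    of index [c] is differentiated once for every occurrence of [c] in [s]. *)
Definition sampling_deriv (I : finType) (w : R) (b : I -> K -> R) (g : I -> J -> R -> R)
    (s : seq J) (kappa : K) (z : V) : R :=
  \sum_i sampling_term w (fun kappa => w ^+ size s * b i kappa)
    (fun c => derive1n (count_mem c s) (g i c)) kappa z.

(** Every word of length at most [p] leads to a series of the same kind, with
    locally uniform tails; induction on the word identifies the iterated partial
    derivatives with these series. *)
Lemma sampling_Cbm (p : nat) (I : finType) (w CB : R) (b : I -> K -> R)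
    (g : I -> J -> R -> R) :
  (forall i kappa, `|b i kappa| <= CB) ->
  (forall i c, smooth_tails p 0 (g i c)) ->
  (forall z, usummable (fun kappa => \sum_i sampling_term w (b i) (g i) kappa z)) /\
  Cbm p (fun z : V => usum (fun kappa => \sum_i sampling_term w (b i) (g i) kappa z)).
Proof.
move=> bC sg.
have cnt c (s : seq J) : (size s <= p)%N -> (count_mem c s <= p)%N.
  by apply: leq_trans; exact: count_size.
have bCs (s : seq J) i kappa : `|w ^+ size s * b i kappa| <= `|w ^+ size s| * CB.
  by rewrite normrM ler_wpM2l.
have cg (s : seq J) i c : (size s <= p)%N ->
    continuous (derive1n (count_mem c s) (g i c)).
  by move=> /(cnt c) sp; case: (sg i c) => _ /(_ _ sp)[].
have tg (s : seq J) i c : (size s <= p)%N ->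
    unif_tails 0 (derive1n (count_mem c s) (g i c)).
  by move=> /(cnt c) sp; case: (sg i c) => _ /(_ _ sp)[].
have lu (s : seq J) : (size s <= p)%N -> loc_unif (sampling_deriv w b g s).
  move=> sp; apply: loc_unif_sum => i.
  exact: (@sampling_term_loc_unif w _ (fun kappa => w ^+ size s * b i kappa)
    (fun c => derive1n (count_mem c s) (g i c)) (bCs s i)
    (fun c => cg s i c sp) (fun c => tg s i c sp)).
have E0 : (fun z : V => usum (fun kappa => \sum_i sampling_term w (b i) (g i) kappa z)) =
    (fun z => usum ((sampling_deriv w b g [::])^~ z)).
  apply/funext => z; congr usum; apply/funext => kappa; apply: eq_bigr => i _.
  by rewrite /sampling_term expr0 mul1r.
have dd (s : seq J) c : (size s < p)%N -> forall kappa z,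
    is_derive z (cdir R c) (sampling_deriv w b g s kappa)
      (sampling_deriv w b g (c :: s) kappa z).
  move=> sp kappa z; rewrite /sampling_deriv.
  have di i : is_derive z (cdir R c)
      (sampling_term w (fun kappa => w ^+ size s * b i kappa)
         (fun c => derive1n (count_mem c s) (g i c)) kappa)
      (sampling_term w (fun kappa => w ^+ size (c :: s) * b i kappa)
         (fun c' => derive1n (count_mem c' (c :: s)) (g i c')) kappa z).
    have dgc (x : R) : derivable (derive1n (count_mem c s) (g i c)) x 1.
      case: (sg i c) => + _; apply; apply: leq_ltn_trans sp; exact: count_size.
    have := @is_derive_sampling_term w (fun kappa => w ^+ size s * b i kappa)
      (fun c => derive1n (count_mem c s) (g i c)) c kappa z dgc.
    congr (is_derive _ _ _ _).
    rewrite /sampling_term /= exprS !mulrA; congr (_ * _); apply: eq_bigr => c' _.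
    by rewrite [c == c']eq_sym; case: eqP => [->|_].
  elim: (index_enum I) => [|i r IH].
    under [X in is_derive _ _ X _]eq_fun do rewrite big_nil.
    by rewrite big_nil; exact: is_derive_cst.
  under [X in is_derive _ _ X _]eq_fun do rewrite big_cons.
  by rewrite big_cons; apply: is_deriveD.
have ds (s : seq J) c z : (size s < p)%N ->
    is_derive z (cdir R c) (fun z => usum ((sampling_deriv w b g s)^~ z))
      (usum ((sampling_deriv w b g (c :: s))^~ z)).
  move=> sp; apply: loc_unif_derive_dir; [exact/lu/ltnW|exact: lu|].
  by move=> t y; exact: dd.
have pE (s : seq J) : (size s <= p)%N ->
    pderivs s (fun z => usum ((sampling_deriv w b g [::])^~ z)) =
    (fun z => usum ((sampling_deriv w b g s)^~ z)).
  elim: s => [_|c s IH sp]; first exact: erefl.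
  apply/funext => z; rewrite [LHS]/= (IH (ltnW sp)).
  by case: (ds s c z sp).
split.
  move=> z; have := loc_unif_summable z (lu [::] (leq0n _)).
  congr usummable; apply/funext => kappa; apply: eq_bigr => i _.
  by rewrite /sampling_term expr0 mul1r.
rewrite E0; split=> s sp.
  by move=> c z; rewrite (pE _ (ltnW sp)); case: (ds s c z sp).
rewrite (pE _ sp); split.
  apply: loc_unif_continuous; first exact: lu.
  move=> kappa z; apply: cvg_big => //=; first by move=> [x y]; exact: add_continuous.
  by move=> i _; apply: sampling_term_continuous => c; exact: cg.
have le i : exists M : R, forall z, sum_le setT
    (fun kappa => sampling_term w (fun kappa => w ^+ size s * b i kappa)
         (fun c => derive1n (count_mem c s) (g i c)) kappa z) M.
  exact: (@sampling_term_le w _ (fun kappa => w ^+ size s * b i kappa)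
    (fun c => derive1n (count_mem c s) (g i c)) (bCs s i)
    (fun c => cg s i c sp) (fun c => tg s i c sp)).
pose M i := sval (cid (le i)).
have MP i z : sum_le setT (fun kappa => sampling_term w (fun kappa => w ^+ size s * b i kappa)
         (fun c => derive1n (count_mem c s) (g i c)) kappa z) (M i).
  by rewrite /M; case: cid.
exists (\sum_i M i); split; first exact: num_real.
move=> x Mx z _ /=; apply: le_trans (ltW Mx); apply: usum_le.
rewrite /sampling_deriv; elim: (index_enum I) => [|i r IH].
  by move=> X _; rewrite big1 ?big_nil// => kappa _; rewrite big_nil normr0.
rewrite big_cons; have := sum_leD (MP i z) IH; apply: sum_leW => // kappa _.
by rewrite big_cons.
Qed.

End sampling.

(** * Integrals of continuous functions over intervals *)

Section integrals.
Variable R : realType.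
Local Notation mu := (@lebesgue_measure R).

Lemma continuous_integrable_itv (a b : R) (f : R -> R) :
  continuous f -> mu.-integrable `[a, b] (EFin \o f).
Proof.
move=> cf; apply: continuous_compact_integrable; first exact: segment_compact.
exact: continuous_subspaceT.
Qed.

Lemma Rintegral_itv_le (a b M : R) (f : R -> R) : a <= b -> continuous f ->
  (forall t, a <= t <= b -> `|f t| <= M) ->
  `|\int[mu]_(t in `[a, b]) f t| <= M * (b - a).
Proof.
move=> ab cf fM.
have nf : continuous (fun t => `|f t|) by move=> t; apply: cvg_norm; exact: cf.
have h : `|\int[mu]_(t in `[a, b]) f t| <= \int[mu]_(t in `[a, b]) `|f t|.
  by apply: le_normr_Rintegral => //; exact: continuous_integrable_itv.
apply: le_trans h _.
have -> : M * (b - a) = \int[mu]_(t in `[a, b]) M.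
  rewrite Rintegral_cst//= lebesgue_measure_itv/= lte_fin.
  case: ltP => // ba; have -> : b = a by apply/eqP; rewrite eq_le ab ba.
  by rewrite subrr.
apply: le_Rintegral => //.
- exact: continuous_integrable_itv nf.
- by apply: continuous_integrable_itv => t; exact: cvg_cst.
Qed.

Lemma Rintegral_itv_sum (a b : R) (I : Type) (r : seq I) (c : I -> R) (f : I -> R -> R) :
  (forall i, continuous (f i)) ->
  \int[mu]_(t in `[a, b]) (\sum_(i <- r) c i * f i t) =
  \sum_(i <- r) c i * \int[mu]_(t in `[a, b]) f i t.
Proof.
move=> cf; elim: r => [|i r IH].
  under eq_Rintegral do rewrite big_nil.
  by rewrite Rintegral_cst//= mul0r big_nil.
under eq_Rintegral do rewrite big_cons.
have cif j : continuous (fun t => c j * f j t).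
  by move=> t; apply: cvgM; [exact: cvg_cst|exact: cf].
rewrite RintegralD//.
- rewrite IH big_cons RintegralZl//; exact: continuous_integrable_itv.
- exact: continuous_integrable_itv.
- apply: (@continuous_integrable_itv a b (fun t => \sum_(j <- r) c j * f j t)) => t.
  by apply: cvg_big => [|j _]; [exact: add_continuous|exact: cif].
Qed.

Lemma continuous_pairing (X Y Z : topologicalType) (f : X -> Y) (g : X -> Z) :
  continuous f -> continuous g -> continuous (fun x => (f x, g x)).
Proof. by move=> cf cg x; exact: cvg_pair (cf x) (cg x). Qed.

Lemma continuous_compose (X Y Z : topologicalType) (f : X -> Y) (g : Y -> Z) :
  continuous f -> continuous g -> continuous (fun x => g (f x)).
Proof. by move=> cf cg x; apply: (@continuous_comp X Y Z f g); [exact: cf|exact: cg]. Qed.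

(** By the tube lemma the integrand is, near a parameter, uniformly close to its
    value at that parameter all along the compact interval. *)
Lemma continuous_parametric_integral (X : topologicalType) (a b : R) (G : X -> R -> R) :
  a <= b -> continuous (fun p : X * R => G p.1 p.2) ->
  continuous (fun x => \int[mu]_(t in `[a, b]) G x t).
Proof.
move=> ab cG x0.
have cGx x : continuous (G x).
  apply: (continuous_compose (f := fun t : R => (x, t)) _ cG).
  apply: (@continuous_pairing R X R (fun=> x) (fun t => t)) => t; first exact: cvg_cst.
  exact: cvg_id.
apply/cvgrPdist_le => e e0.
pose e' := e / (b - a + 1).
have e'0 : 0 < e' by rewrite divr_gt0//; lra.
have tube : \forall x \near x0, `[a, b] `<=` (fun t => `|G x0 t - G x t| <= e').
  have /compact_near_coveringP cov := @segment_compact R a b.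
  apply: (cov X (nbhs x0) (fun x t => `|G x0 t - G x t| <= e')) => t _.
  have c1 : \forall p \near (x0, t), `|G x0 t - G p.1 p.2| <= e' / 2.
    by have /cvgrPdist_le := cG (x0, t); apply; rewrite divr_gt0.
  have c2 : \forall t' \near t, `|G x0 t - G x0 t'| <= e' / 2.
    by have /cvgrPdist_le := cGx x0 t; apply; rewrite divr_gt0.
  have [[U W] /= [Ux Wt] UW] := c1.
  exists (W `&` (fun t' => `|G x0 t - G x0 t'| <= e' / 2), U).
    by split => //=; exact: filterI.
  move=> [t' x] /= [[Wt' ct'] Ux'].
  have /= := UW (x, t') (conj Ux' Wt').
  by move: ct'; rewrite !ler_norml; lra.
near=> x.
have dx : `[a, b] `<=` (fun t => `|G x0 t - G x t| <= e') by near: x.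
rewrite -RintegralB//; [|exact: continuous_integrable_itv..].
apply: (@le_trans _ _ (e' * (b - a))).
  by apply: Rintegral_itv_le => // t; apply: cvgB; exact: cGx.
rewrite /e' mulrAC ler_pdivrMr; last by lra.
by apply: ler_wpM2l; [exact: ltW|lra].
Unshelve. all: by end_near. Qed.

Lemma continuous_row (X : topologicalType) (d : nat) (F : X -> 'rV[R]_d) :
  (forall j, continuous (fun x => F x 0 j)) -> continuous F.
Proof.
move=> cF x A [P PA sub]; apply: (filterS sub).
apply: (@filter_forall _ _ (fun i x => forall j, P i j (F x i j))) => i.
apply: (@filter_forall _ _ (fun j x => P i j (F x i j))) => j.
by have := PA i j; rewrite (ord1 i) => h; exact: (cF j x _ h).
Qed.

End integrals.

(** * Iterated integrals over cells *)

Section boxes.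
Variables (R : realType) (d : nat).
Local Notation mu := (@lebesgue_measure R).
Local Notation V := (R * 'rV[R]_d)%type.

Definition set_coord (i : 'I_d) (t : R) (v : 'rV[R]_d) : 'rV[R]_d :=
  \row_j (if j == i then t else v 0 j).

Lemma set_coord_continuous (i : 'I_d) :
  continuous (fun p : V * R => (p.1.1, set_coord i p.2 p.1.2)).
Proof.
apply: continuous_pairing.
  by apply: continuous_compose => z; exact: cvg_fst.
apply: continuous_row => j.
under [X in continuous X]eq_fun do rewrite mxE.
case: eqP => _; first by move=> p; exact: cvg_snd.
apply: (@continuous_compose (V * R)%type V R fst (fun z => z.2 0 j)) => z.
  exact: cvg_fst.
exact: (@coord_continuous_pair R d (Some j)).
Qed.

Section fixed_box.
Variables (lo hi : 'I_d -> R).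
Hypothesis lohi : forall i, lo i <= hi i.

(** The iterated integral defining [box_integral], cut off at a list of
    coordinates and seen as a function of all variables: joint continuity in the
    variables not yet integrated is what makes the next integral behave. *)
Definition iter_int (s : seq 'I_d) (g : V -> R) (z : V) : R :=
  foldr (fun (i : 'I_d) (h : 'rV[R]_d -> R) (v : 'rV[R]_d) =>
           \int[mu]_(t in `[lo i, hi i]) h (set_coord i t v))
    (fun v => g (z.1, v)) s z.2.

Lemma iter_int_nil g z : iter_int [::] g z = g z.
Proof. by case: z. Qed.

Lemma iter_int_cons i s g z : iter_int (i :: s) g z =
  \int[mu]_(t in `[lo i, hi i]) iter_int s g (z.1, set_coord i t z.2).
Proof. by []. Qed.

Lemma iter_int_continuous s g : continuous g -> continuous (iter_int s g).
Proof.
move=> cg; elim: s => [|i s IH].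
  by rewrite (_ : iter_int [::] g = g)//; apply/funext => z; exact: iter_int_nil.
rewrite (_ : iter_int (i :: s) g = fun z =>
  \int[mu]_(t in `[lo i, hi i]) iter_int s g (z.1, set_coord i t z.2))//.
apply: (@continuous_parametric_integral R V (lo i) (hi i)
  (fun z t => iter_int s g (z.1, set_coord i t z.2)) (lohi i)).
exact: (@continuous_compose (V * R)%type V R _ (iter_int s g) (@set_coord_continuous i) IH).
Qed.

Lemma iter_int_slice s g i z : continuous g ->
  continuous (fun t => iter_int s g (z.1, set_coord i t z.2)).
Proof.
move=> cg; have c1 : continuous (fun t : R => (z, t)).
  by apply: (@continuous_pairing R V R (fun=> z) (fun t => t)) => t;
    [exact: cvg_cst|exact: cvg_id].
have c2 := @continuous_compose R (V * R)%type V _ _ c1 (@set_coord_continuous i).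
exact: (@continuous_compose R V R _ _ c2 (@iter_int_continuous s g cg)).
Qed.

Lemma iter_int_sum s (I : Type) (r : seq I) (c : I -> R) (g : I -> V -> R) z :
  (forall i, continuous (g i)) ->
  iter_int s (fun z => \sum_(i <- r) c i * g i z) z =
  \sum_(i <- r) c i * iter_int s (g i) z.
Proof.
move=> cg; elim: s z => [|j s IH] z.
  by rewrite iter_int_nil; apply: eq_bigr => i _; rewrite iter_int_nil.
rewrite iter_int_cons; under eq_Rintegral do rewrite IH.
apply: (@Rintegral_itv_sum _ _ _ _ _ _
  (fun i t => iter_int s (g i) (z.1, set_coord j t z.2))) => i.
exact: iter_int_slice.
Qed.

(** The induction needs the coordinates that are not integrated to lie in the box
    already; for the full list of coordinates this is no condition. *)
Lemma iter_int_le (s : seq 'I_d) (g : V -> R) (M h : R) (z : V) : continuous g ->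
  (forall i, hi i - lo i = h) ->
  (forall v : 'rV[R]_d, (forall j, lo j <= v 0 j <= hi j) -> `|g (z.1, v)| <= M) ->
  (forall j, j \notin s -> lo j <= z.2 0 j <= hi j) ->
  `|iter_int s g z| <= M * h ^+ size s.
Proof.
move=> cg hE; elim: s z => [|i s IH] z gM zs.
  by rewrite iter_int_nil mulr1; case: z gM zs => u v gM zs; apply: gM => j; exact: zs.
rewrite iter_int_cons [size _]/= exprSr mulrA -{2}(hE i).
apply: Rintegral_itv_le => //; first exact: iter_int_slice.
move=> t ti; apply: IH => // j js; rewrite mxE; case: ifPn => [/eqP -> //|ji].
by apply: zs; rewrite inE negb_or ji.
Qed.

End fixed_box.

Section cells.
Variables (w : R) (kappa : {ffun option 'I_d -> int}).
Hypothesis w0 : 0 < w.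

Definition cell_integral (g : V -> R) : R :=
  \int[mu]_(u in cell w (kappa None))
    box_integral (fun i => cell w (kappa (Some i))) (fun v => g (u, v)).

Let lo (i : 'I_d) : R := (kappa (Some i))%:~R / w.
Let hi (i : 'I_d) : R := (kappa (Some i) + 1)%:~R / w.

Let cell_le (k : int) : k%:~R / w <= (k + 1)%:~R / w.
Proof. by rewrite ler_pM2r ?invr_gt0// intrD lerDl. Qed.

Let cell_len (k : int) : (k + 1)%:~R / w - k%:~R / w = w^-1.
Proof. by rewrite intrD mulrDl addrC addKr mul1r. Qed.

Let cell_integralE g : cell_integral g =
  \int[mu]_(u in `[(kappa None)%:~R / w, (kappa None + 1)%:~R / w])
    iter_int lo hi (enum 'I_d) g (u, 0).
Proof. by []. Qed.

Let slice_continuous g : continuous g ->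
  continuous (fun u : R => iter_int lo hi (enum 'I_d) g (u, 0)).
Proof.
move=> cg; have c1 : continuous (fun u : R => (u, 0 : 'rV[R]_d)).
  by apply: (@continuous_pairing R R 'rV[R]_d (fun u => u) (fun=> 0)) => u;
    [exact: cvg_id|exact: cvg_cst].
exact: (@continuous_compose R V R _ _ c1
  (@iter_int_continuous lo hi (fun i => cell_le _) (enum 'I_d) g cg)).
Qed.

Lemma cell_integral_sum (I : Type) (r : seq I) (c : I -> R) (g : I -> V -> R) :
  (forall i, continuous (g i)) ->
  cell_integral (fun z => \sum_(i <- r) c i * g i z) =
  \sum_(i <- r) c i * cell_integral (g i).
Proof.
move=> cg; rewrite cell_integralE; under eq_Rintegral do
  rewrite (iter_int_sum (fun i => cell_le _)) //.
apply: (@Rintegral_itv_sum _ _ _ _ _ _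
  (fun i u => iter_int lo hi (enum 'I_d) (g i) (u, 0))) => i.
exact: slice_continuous.
Qed.

Lemma cell_integral_le (g : V -> R) (M : R) : continuous g ->
  (forall z, (forall c, 0 <= coord c z - (kappa c)%:~R / w <= w^-1) -> `|g z| <= M) ->
  `|cell_integral g| <= M * w^-1 ^+ d.+1.
Proof.
move=> cg gM; rewrite cell_integralE exprSr mulrA -[X in _ <= _ * X](cell_len (kappa None)).
apply: Rintegral_itv_le; [exact: cell_le|exact: slice_continuous|move=> u uk].
rewrite -[X in _ ^+ X](size_enum_ord d).
apply: iter_int_le => // [i|i|v vk|j]; [exact: cell_le|exact: cell_len| |by rewrite mem_enum].
apply: gM => -[i|] /=.
  by have := vk i; have := cell_len (kappa (Some i)); rewrite /lo /hi; lra.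
by have := cell_len (kappa None); lra.
Qed.

End cells.

End boxes.

(** * The means over cells as polynomials *)

Section hermite.
Variables (R : realType) (d : nat).
Local Notation V := (R * 'rV[R]_d)%type.
Local Notation J := (option 'I_d).
Local Notation K := ({ffun J -> int}).

Lemma prod_option (F : J -> R) : \prod_c F c = F None * \prod_i F (Some i).
Proof.
rewrite (bigD1 None)//=; congr (_ * _).
rewrite (reindex_omap Some id) => [|[i|]]//=.
by apply: eq_bigl => i; rewrite eqxx.
Qed.

(** The binomial formula with a range of summation independent of the exponent,
    so that products over coordinates can be expanded over a common index type. *)
Lemma exprD_widen (n l : nat) (x y : R) : (l <= n)%N ->
  (x + y) ^+ l = \sum_(a < n.+1) y ^+ a * ('C(l, a)%:R * x ^+ (l - a)).
Proof.
move=> ln; rewrite exprDn.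
rewrite (big_ord_widen n.+1 (fun i => (x ^+ (l - i) * y ^+ i) *+ 'C(l, i)))//.
rewrite big_mkcond/=; apply: eq_bigr => a _.
case: ltnP => [_|la]; last by rewrite bin_small// mul0r mulr0.
by rewrite -mulr_natl; ring.
Qed.

Definition bounded_family (T : Type) (b : T -> R) := exists C : R, forall t, `|b t| <= C.

Lemma bounded_familyZ T (c : R) (b : T -> R) :
  bounded_family b -> bounded_family (fun t => c * b t).
Proof.
by move=> [C bC]; exists (`|c| * C) => t; rewrite normrM ler_wpM2l.
Qed.

Lemma bounded_family_sum T (I : Type) (r : seq I) (P : pred I) (b : I -> T -> R) :
  (forall i, P i -> bounded_family (b i)) ->
  bounded_family (fun t => \sum_(i <- r | P i) b i t).
Proof.
move=> bb; elim: r => [|i r [C IH]].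
  by exists 0 => t; rewrite big_nil normr0.
case Pi : (P i).
  have [D bD] := bb i Pi; exists (D + C) => t; rewrite big_cons Pi.
  by apply: le_trans (ler_normD _ _) _; apply: lerD.
by exists C => t; rewrite big_cons Pi.
Qed.

Lemma size_mixed_word (l : nat) (j : 'I_d -> nat) :
  size (mixed_word l j) = (l + \sum_i j i)%N.
Proof.
rewrite size_cat size_nseq size_flatten /shape -map_comp sumnE big_map big_enum/=.
by congr addn; apply: eq_bigr => i _; rewrite size_nseq.
Qed.

Variables (n : nat) (w : R) (f : V -> R).
Hypothesis w0 : 0 < w.
Hypothesis fC : Cbm n f.

Definition degrees (l : nat) (j : 'I_d -> nat) (c : J) : nat :=
  if c is Some i then j i else l.

(** The coefficient of [prod_c (z_c - kappa_c / w)^(alpha_c)] in the integrand of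
    the mean, once the powers [(z_c - zeta_c)^l] have been expanded around
    [kappa_c / w]; it vanishes through the binomials when [alpha] is too large. *)
Definition cell_moment (l : nat) (j : 'I_d -> nat) (alpha : J -> nat) (kappa : K)
    (zeta : V) : R :=
  pderivs (mixed_word l j) f zeta *
  \prod_c ('C(degrees l j c, alpha c)%:R *
     ((kappa c)%:~R / w - coord c zeta) ^+ (degrees l j c - alpha c)).

Lemma cell_moment_continuous l j alpha kappa : (l + \sum_i j i <= n)%N ->
  continuous (cell_moment l j alpha kappa).
Proof.
move=> ljn z; have [cD _] : Cb (pderivs (mixed_word l j) f).
  by apply: fC.2; rewrite size_mixed_word.
apply: cvgM; first exact: cD.
apply: cvg_big => [|c _]; first by move=> [x y]; exact: mul_continuous.
apply: cvgM; first exact: cvg_cst.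
apply: (@continuous_compose V R R
  (fun zeta => (kappa c)%:~R / w - coord c zeta) (fun x => x ^+ _)) => [x|x].
  by apply: cvgB; [exact: cvg_cst|exact: coord_continuous_pair].
exact: exprn_continuous.
Qed.

(** The bound depends on the size of the cell but not on its position. *)
Lemma cell_moment_bounded l j alpha : (l + \sum_i j i <= n)%N ->
  bounded_family (fun kappa => cell_integral w kappa (cell_moment l j alpha kappa)).
Proof.
move=> ljn; have [_ [M [_ DM]]] : Cb (pderivs (mixed_word l j) f).
  by apply: fC.2; rewrite size_mixed_word.
have {}DM z : `|pderivs (mixed_word l j) f z| <= M + 1.
  by apply: (DM (M + 1)); rewrite ?ltrDl.
pose B := \prod_c ('C(degrees l j c, alpha c)%:R * w^-1 ^+ (degrees l j c - alpha c)).
exists ((M + 1) * B * w^-1 ^+ d.+1) => kappa.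
apply: cell_integral_le => //; first exact: cell_moment_continuous.
move=> z zk; rewrite normrM; apply: ler_pM => //.
rewrite normr_prod /B.
apply: ler_prod => c _; rewrite normr_ge0/= normrM normr_nat ler_wpM2l// normrX.
apply: lerXn2r; rewrite ?nnegrE//; first by rewrite invr_ge0 ltW.
by rewrite distrC ger0_norm; case/andP: (zk c).
Qed.

(** The powers of [w^-1] turn the variables [z_c - kappa_c / w] into
    [w z_c - kappa_c]. *)
Definition hermite_coef (alpha : {ffun J -> 'I_n.+1}) (kappa : K) : R :=
  \prod_c w^-1 ^+ alpha c *
  \sum_(l < n.+1) \sum_(j : {ffun 'I_d -> 'I_n.+1} | (l + \sum_(i < d) j i <= n)%N)
    ((l`!)%:R * \prod_(i < d) ((j i)`!)%:R)^-1 * w ^+ d.+1 *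
    cell_integral w kappa (cell_moment l (fun i => j i) (fun c => alpha c) kappa).

Lemma hermite_coef_bounded alpha : bounded_family (hermite_coef alpha).
Proof.
apply: bounded_familyZ; apply: bounded_family_sum => l _.
apply: bounded_family_sum => j ljn; apply: bounded_familyZ.
exact: cell_moment_bounded.
Qed.

Lemma hermite_meanE (k : int) (m : {ffun 'I_d -> int}) (kappa : K) (z : V) :
  kappa None = k -> (forall i, kappa (Some i) = m i) ->
  hermite_mean n w f k m z.1 z.2 =
  \sum_(alpha : {ffun J -> 'I_n.+1})
    hermite_coef alpha kappa * \prod_c (w * coord c z - (kappa c)%:~R) ^+ alpha c.
Proof.
move=> kE mE.
pose x c := coord c z - (kappa c)%:~R / w.
have xE (alpha : {ffun J -> 'I_n.+1}) :
    \prod_c w^-1 ^+ alpha c * \prod_c (w * coord c z - (kappa c)%:~R) ^+ alpha c =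
    \prod_c x c ^+ alpha c.
  rewrite -big_split/=; apply: eq_bigr => c _; rewrite -exprMn; congr (_ ^+ _).
  by rewrite /x mulrBr mulKf ?gt_eqF// mulrC.
under [RHS]eq_bigr do rewrite /hermite_coef mulrAC xE mulr_sumr.
rewrite exchange_big/=; apply: eq_bigr => l _.
under [RHS]eq_bigr do rewrite mulr_sumr.
rewrite exchange_big/=; apply: eq_bigr => j ljn.
under [RHS]eq_bigr do rewrite mulrCA.
rewrite -mulr_sumr; congr (_ * _).
pose G (alpha : {ffun J -> 'I_n.+1}) :=
  cell_moment l (fun i => j i) (fun c => alpha c) kappa.
have cG alpha : continuous (G alpha) by exact: cell_moment_continuous.
transitivity (cell_integral w kappa
    (fun zeta => \sum_alpha (\prod_c x c ^+ (alpha : {ffun J -> 'I_n.+1}) c) * G alpha zeta));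
  last exact: (@cell_integral_sum R d w kappa w0 _ (index_enum {ffun J -> 'I_n.+1})
    (fun alpha : {ffun J -> 'I_n.+1} => \prod_c x c ^+ alpha c) G cG).
rewrite /cell_integral kE.
have -> : (fun i : 'I_d => cell w (kappa (Some i))) = (fun i => cell w (m i)).
  by apply/funext => i; rewrite mE.
apply: eq_Rintegral => u _; congr box_integral; apply/funext => v.
rewrite /G /cell_moment.
under [RHS]eq_bigr do rewrite mulrCA -big_split/=.
rewrite -mulr_sumr -mulrA; congr (_ * _).
rewrite -(bigA_distr_bigA (fun c (a : 'I_n.+1) => x c ^+ a *
  ('C(degrees l (fun i => j i) c, a)%:R *
     ((kappa c)%:~R / w - coord c (u, v)) ^+ (degrees l (fun i => j i) c - a))))/=.
rewrite (eq_bigr (fun c => (coord c z - coord c (u, v)) ^+ degrees l (fun i => j i) c)).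
  by rewrite prod_option.
move=> c _; rewrite -exprD_widen; last by case: c => [i|]; rewrite /= -ltnS ltn_ord.
by rewrite /x addrC subrKA.
Qed.

End hermite.

(** * The sampling Kantorovich operator *)

Lemma kernel_smooth_tails (R : realType) (p n : nat) (chi : R -> R) :
  kernel_of_order n chi -> Cbm_line p chi ->
  (forall q, (1 <= q <= p)%N -> moment_cvg_unif n (derive1n q chi)) ->
  smooth_tails p n chi.
Proof.
move=> [_ chi_unif _] [dchi cchi] dchi_unif; split=> // q qp.
split; first by case: (cchi q qp).
by apply: moment_unif_tails; case: q qp => [//|q] qp; exact: dchi_unif.
Qed.

Theorem proposition1 (R : realType) (d p n : nat)
    (phi : R -> R) (psi : 'I_d -> R -> R)
    (d_ge1 : (1 <= d)%N) (p_ge1 : (1 <= p)%N)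
    (phi_kernel : kernel_of_order n phi)
    (psi_kernel : forall i, kernel_of_order n (psi i))
    (phi_Cbp : Cbm_line p phi)
    (psi_Cbp : forall i, Cbm_line p (psi i))
    (dphi_unif : forall q : nat, (1 <= q <= p)%N ->
       moment_cvg_unif n (derive1n q phi))
    (dpsi_unif : forall (q : nat) (i : 'I_d), (1 <= q <= p)%N ->
       moment_cvg_unif n (derive1n q (psi i)))
    (f : R * 'rV[R]_d -> R) (f_Cbn : Cbm n f) (w : R) (w_gt0 : 0 < w) :
  (forall z, hermite_kantorovich_cvg n phi psi w f z) /\
  Cbm p (hermite_kantorovich n phi psi w f).
Proof.
pose chi (c : option 'I_d) := if c is Some i then psi i else phi.
have chi_smooth c : smooth_tails p n (chi c).
  case: c => [i|]; last exact: kernel_smooth_tails.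
  exact: (kernel_smooth_tails (psi_kernel i) (psi_Cbp i) (fun q => dpsi_unif q i)).
pose g (alpha : {ffun option 'I_d -> 'I_n.+1}) c (x : R) := x ^+ alpha c * chi c x.
have g_smooth alpha c : smooth_tails p 0 (g alpha c).
  by apply: smooth_tails_monomial (chi_smooth c); rewrite -ltnS.
pose b := @hermite_coef R d n w f.
pose CB alpha := sval (cid (hermite_coef_bounded w_gt0 f_Cbn alpha)).
have bC alpha kappa : `|b alpha kappa| <= \sum_alpha `|CB alpha|.
  apply: (@le_trans _ _ (CB alpha)).
    by rewrite /CB /b; case: cid.
  apply: le_trans (ler_norm _) _.
  by rewrite [leRHS](bigD1 alpha)//= lerDl sumr_ge0.
have [S_summable S_smooth] := sampling_Cbm w bC g_smooth.
pose e (t : int * {ffun 'I_d -> int}) : {ffun option 'I_d -> int} :=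
  [ffun c => if c is Some i then t.2 i else t.1].
have e_bij : bijective e.
  exists (fun kappa : {ffun option 'I_d -> int} =>
    (kappa None, [ffun i => kappa (Some i)])) => [[k m]|kappa].
    by rewrite !ffunE/=; congr pair; apply/ffunP => i; rewrite !ffunE.
  by apply/ffunP => -[i|]; rewrite !ffunE/= ?ffunE.
have termE z k m : hermite_term n phi psi w f z k m =
    \sum_alpha sampling_term w (b alpha) (g alpha) (e (k, m)) z.
  rewrite /hermite_term (@hermite_meanE _ _ _ _ _ w_gt0 f_Cbn k m (e (k, m)) z).
  - rewrite mulr_sumr; apply: eq_bigr => alpha _.
    rewrite /sampling_term big_split/= [\prod_c chi _ _]prod_option/=.
    rewrite mulrCA; congr (_ * _); rewrite mulrC; congr (_ * (_ * _)).
      by rewrite ffunE.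
    by apply: eq_bigr => i _; rewrite ffunE.
  - by rewrite ffunE.
  - by move=> i; rewrite ffunE.
have pairs z : usummable (fun t : int * {ffun 'I_d -> int} =>
    hermite_term n phi psi w f z t.1 t.2).
  have /usummableP[M SM] := S_summable z.
  apply/usummableP; exists M.
  move/(reindex_sum_le _ _ e_bij): SM; apply: sum_leW => // -[k m] _.
  by rewrite termE.
split; first by move=> z; have [] := usum_pair (pairs z).
rewrite (_ : hermite_kantorovich n phi psi w f = fun z =>
  usum (fun kappa => \sum_alpha sampling_term w (b alpha) (g alpha) kappa z))//.
apply/funext => z; rewrite /hermite_kantorovich; have [_ _ ->] := usum_pair (pairs z).
rewrite -(reindex_usum _ e_bij); congr usum; apply/funext => -[k m].
exact: termE.
Qed.
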